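(* Let $(R,\mathfrak m)$ be a Noetherian (standard graded) local ring with $\mathfrak m^2\neq 0$. Then $$\operatorname{ms}(R)=\min\{\mu(I) : I \text{ is a reduction of } \mathfrak m \text{ with reduction number one}\}.$$
   Context: All rings are commutative with unity. A ''Noetherian (standard graded) local ring $(R,\mathfrak m)$'' means either a Noetherian local ring with unique maximal ideal $\mathfrak m$, or a Noetherian standard graded ring $R=\bigoplus_{i\ge 0}R_i$ with $R_0$ a field, $R=R_0[R_1]$ and homogeneous maximal ideal $\mathfrak m=\bigoplus_{i\ge1}R_i$; in the graded case the ideals considered are homogeneous (this is the meaning of ''(homogeneous)'' below). Put $k=R/\mathfrak m$ and $\mu(I)=\dim_k(I/\mathfrak m I)$, the minimal number of generators of an ideal $I$. Define $$\operatorname{ms}(R)=\min\{\mu(I): I\subseteq \mathfrak m \text{ is a (homogeneous) ideal of } R \text{ such that } I\supseteq \mathfrak m^2\}.$$ An ideal $J\subseteq I$ is a reduction of $I$ if there exists an integer $r\ge 0$ such that $I^{r+1}=I^rJ$; the least integer $r$ such that $I^{r+1}=I^rJ$ is the reduction number of $I$ with respect to $J$. ''$I$ is a reduction of $\mathfrak m$ with reduction number one'' means that $I\subseteq\mathfrak m$ is a reduction of $\mathfrak m$ and the reduction number of $\mathfrak m$ with respect to $I$ is one.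
   Formalization: As in a DVR, there may be no reduction of m with reduction number exactly one, so the minimum is undefined; the equality is proved when such a reduction exists, and in general with reduction number at most one. *)

(* Defs.v *)
From HB Require Import structures.
From mathcomp Require Import all_boot all_order all_algebra.
From mathcomp Require Import boolp classical_sets.

Set Implicit Arguments.
Unset Strict Implicit.
Unset Printing Implicit Defensive.

Import GRing.Theory.
Local Open Scope classical_set_scope.
Local Open Scope ring_scope.

Definition is_min (A : set nat) (n : nat) : Prop :=
  A n /\ forall k, A k -> (n <= k)%N.

(* The value is 0 when A is empty. *)
Definition setmin (A : set nat) : nat := xget 0%N [set n | is_min A n].

Section Ideals.
Variable R : comNzRingType.
Implicit Types I J m : set R.

(* Unlike idealr_closed, this allows the unit ideal. *)
Definition is_ideal I : Prop :=
  [/\ I 0, (forall x y, I x -> I y -> I (x + y))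
         & (forall a x, I x -> I (a * x))].

Definition ideal_mul I J : set R :=
  smallest is_ideal [set z | exists x y, [/\ I x, J y & z = x * y]].

Definition ideal_exp I (r : nat) : set R := iter r (ideal_mul I) setT.

Definition noetherian : Prop :=
  forall I, is_ideal I -> exists s : seq R, I = smallest is_ideal [set` s].

Definition maximal_ideal m : Prop :=
  [/\ is_ideal m, m <> setT
    & forall J, is_ideal J -> m `<=` J -> J = m \/ J = setT].

Definition local_ring m : Prop :=
  maximal_ideal m /\ forall m', maximal_ideal m' -> m' = m.

(* G i is the homogeneous component R_i of a grading R = (+)_(i >= 0) R_i. *)
Definition is_grading (G : nat -> set R) : Prop :=
  [/\ (forall i, zmod_closed (mem (G i))),
      G 0%N 1 /\ (forall i j x y, G i x -> G j y -> G (i + j)%N (x * y)),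
      (forall x, exists n (c : nat -> R),
         (forall i, G i (c i)) /\ x = \sum_(i < n) c i)
    & (forall n (c : nat -> R), (forall i, G i (c i)) ->
         \sum_(i < n) c i = 0 -> forall i, (i < n)%N -> c i = 0)].

Definition standard_grading (G : nat -> set R) : Prop :=
  [/\ is_grading G,
      (forall x, G 0%N x -> x != 0 -> exists2 y, G 0%N y & x * y = 1)
    & smallest (fun A : set R => subring_closed (mem A)) (G 0%N `|` G 1%N)
        = setT].

(* The ideal (+)_(i >= 1) R_i. *)
Definition irrelevant_ideal (G : nat -> set R) : set R :=
  [set x | exists n (c : nat -> R),
     (forall i, G i.+1 (c i)) /\ x = \sum_(i < n) c i].

Definition homogeneous_ideal (G : nat -> set R) I : Prop :=
  is_ideal I /\
  forall n (c : nat -> R), (forall i, G i (c i)) -> I (\sum_(i < n) c i) ->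
    forall i, (i < n)%N -> I (c i).

(* [local_or_standard_graded m adm]: R is a Noetherian local ring with maximal
   ideal m, and adm is the class of all ideals; or R is a Noetherian standard
   graded ring with homogeneous maximal ideal m, and adm is the class of
   homogeneous ideals. *)
Variant local_or_standard_graded : set R -> set (set R) -> Prop :=
| LocalRing m :
    noetherian -> local_ring m -> local_or_standard_graded m is_ideal
| StandardGradedRing (G : nat -> set R) :
    noetherian -> standard_grading G ->
    local_or_standard_graded (irrelevant_ideal G) (homogeneous_ideal G).

(* The classes of e_0, ..., e_(n-1) form a basis of I / m I over k = R / m;
   scalars in k are represented by elements of R. *)
Definition is_basis_mod m I n (e : 'I_n -> R) : Prop :=
  [/\ (forall i, I (e i)),
      (forall x, I x ->
         exists a : 'I_n -> R, ideal_mul m I (x - \sum_i a i * e i))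
    & (forall a : 'I_n -> R,
         ideal_mul m I (\sum_i a i * e i) -> forall i, m (a i))].

(* dim_k (I / m I) (0 if there is no finite basis, which cannot happen when R
   is Noetherian and m is maximal). *)
Definition mu m I : nat :=
  xget 0%N [set n | exists e : 'I_n -> R, is_basis_mod m I e].

Definition ms m (adm : set (set R)) : nat :=
  setmin [set mu m I | I in
    [set I | [/\ adm I, I `<=` m & ideal_exp m 2 `<=` I]]].

Definition reduction J I : Prop :=
  J `<=` I /\ exists r, ideal_exp I r.+1 = ideal_mul (ideal_exp I r) J.

Definition reduction_number I J : nat :=
  setmin [set r | ideal_exp I r.+1 = ideal_mul (ideal_exp I r) J].

Definition reductions_number_le1 m (adm : set (set R)) : set (set R) :=
  [set I | [/\ adm I, reduction I m & (reduction_number m I <= 1)%N]].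

(* This set can be empty: in a discrete valuation ring, m itself is the only
   reduction I of m with m^2 = m I, and it has reduction number 0. It belongs
   to reductions_number_le1, which is never empty. *)
Definition reductions_number_one m (adm : set (set R)) : set (set R) :=
  [set I | [/\ adm I, reduction I m & reduction_number m I = 1%N]].

End Ideals.

(* Main.v *)
(** Write [ell] for length over [k = R / m]. If [m^2 <= I <= m] and [m I <> m^2],
    pick [z] and [w] in [m] with [z w] outside [m I], and put [I' = I + (z)].
    Since [z m <= m^2 <= I],
      [mu I' = ell (I' / I) + ell (I / m I') <= 1 + (mu I - 1)],
    so enlarging [I] to [I'] does not increase [mu], while [ell (m^2 / m I)]
    drops. Iterating ends with [m I = m^2] (in the graded case [z] is taken
    homogeneous). Conversely [m I = m^2] forces [m^2 <= I]. *)
Require Import Defs.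
From mathcomp Require Import all_boot all_order all_algebra.
From mathcomp Require Import boolp classical_sets.
From mathcomp Require Import ring.
Set Implicit Arguments.
Unset Strict Implicit.
Unset Printing Implicit Defensive.

Import GRing.Theory.
Local Open Scope classical_set_scope.
Local Open Scope ring_scope.

(** By well-ordering, the default value 0 of [setmin] is never reached when [A] is inhabited. *)
Lemma setminP (A : set nat) n : A n -> is_min A (setmin A).
Proof.
move=> An; rewrite /setmin; case: xgetP => [// | noMin].
have exA : exists k, `[< A k >] by exists n; apply/asboolP.
case: (ex_minnP exA) => k /asboolP Ak kmin.
by case: (noMin k); split=> // j Aj; apply: kmin; apply/asboolP.
Qed.

(** * Products, powers and one-element extensions of ideals *)

Section IdealArithmetic.
Variable R : comNzRingType.
Implicit Types (I J K m : set R) (x y z : R).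

Lemma ideal0 I : is_ideal I -> I 0. Proof. by case. Qed.

Lemma idealD I x y : is_ideal I -> I x -> I y -> I (x + y).
Proof. by case=> _ + _; apply. Qed.

Lemma idealM I a x : is_ideal I -> I x -> I (a * x).
Proof. by case=> _ _; apply. Qed.

Lemma idealN I x : is_ideal I -> I x -> I (- x).
Proof. by move=> idI Ix; rewrite -mulN1r; apply: idealM. Qed.

Lemma idealB I x y : is_ideal I -> I x -> I y -> I (x - y).
Proof. by move=> idI Ix Iy; apply: idealD => //; apply: idealN. Qed.

Lemma ideal_sum I n (F : 'I_n -> R) :
  is_ideal I -> (forall i, I (F i)) -> I (\sum_i F i).
Proof.
move=> idI IF; elim/big_ind: _ => [|x y|i _]; [exact: ideal0| |exact: IF].
exact: idealD.
Qed.

Lemma smallest_ideal (S : set R) : is_ideal (smallest (@is_ideal R) S).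
Proof.
split=> [K [idK _]|x y Kx Ky K idSK|a x Kx K idSK].
- exact: ideal0.
- by apply: idealD (Kx K idSK) (Ky K idSK); case: idSK.
- by apply: idealM (Kx K idSK); case: idSK.
Qed.

Lemma ideal_mul_ideal I J : is_ideal (ideal_mul I J).
Proof. exact: smallest_ideal. Qed.

Lemma mem_ideal_mul I J x y : I x -> J y -> ideal_mul I J (x * y).
Proof. by move=> Ix Jy K [_]; apply; exists x, y. Qed.

Lemma ideal_mul_sub I J K : is_ideal K ->
  (forall x y, I x -> J y -> K (x * y)) -> ideal_mul I J `<=` K.
Proof.
move=> idK IJK u; apply; split=> // _ [x [y [Ix Jy ->]]].
exact: IJK.
Qed.

Lemma ideal_mulSr I J K : J `<=` K -> ideal_mul I J `<=` ideal_mul I K.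
Proof.
move=> JK; apply: ideal_mul_sub => [|x y Ix Jy]; first exact: ideal_mul_ideal.
by apply: mem_ideal_mul => //; apply: JK.
Qed.

Lemma ideal_mul_subr I J : is_ideal J -> ideal_mul I J `<=` J.
Proof. by move=> idJ; apply: ideal_mul_sub => // x y _; apply: idealM. Qed.

Lemma ideal_mulTl I : is_ideal I -> ideal_mul setT I = I.
Proof.
move=> idI; apply/seteqP; split; first exact: ideal_mul_subr.
by move=> x Ix; rewrite -[x]mul1r; apply: mem_ideal_mul.
Qed.

Lemma ideal_mulTr I : is_ideal I -> ideal_mul I setT = I.
Proof.
move=> idI; apply/seteqP; split.
  by apply: ideal_mul_sub => // x y Ix _; rewrite mulrC; apply: idealM.
by move=> x Ix; rewrite -[x]mulr1; apply: mem_ideal_mul.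
Qed.

Lemma ideal_exp1 I : is_ideal I -> ideal_exp I 1 = I.
Proof. exact: ideal_mulTr. Qed.

Lemma ideal_exp2 I : is_ideal I -> ideal_exp I 2 = ideal_mul I I.
Proof. by move=> idI; rewrite -{3}(ideal_exp1 idI). Qed.

Definition adjoin I z : set R := [set x | exists y a, I y /\ x = y + a * z].

Lemma adjoin_ideal I z : is_ideal I -> is_ideal (adjoin I z).
Proof.
move=> idI; split.
- by exists 0, 0; split; [exact: ideal0|ring].
- move=> _ _ [y [a [Iy ->]]] [y' [a' [Iy' ->]]].
  by exists (y + y'), (a + a'); split; [exact: idealD|ring].
- move=> b _ [y [a [Iy ->]]].
  by exists (b * y), (b * a); split; [exact: idealM|ring].
Qed.

Lemma sub_adjoin I z : I `<=` adjoin I z.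
Proof. by move=> y Iy; exists y, 0; split=> //; ring. Qed.

Lemma mem_adjoin I z : is_ideal I -> adjoin I z z.
Proof. by move=> idI; exists 0, 1; split; [exact: ideal0|ring]. Qed.

Lemma adjoin_sub I J z : is_ideal J -> I `<=` J -> J z -> adjoin I z `<=` J.
Proof.
move=> idJ IJ Jz _ [y [a [/IJ Jy ->]]].
by apply: idealD => //; apply: idealM.
Qed.

End IdealArithmetic.

(** * Linear algebra over [R / m] with scalars lifted to [R], and its consequences for [mu] *)

Section Spanning.
Variable R : comNzRingType.
Implicit Types (I J K L m M N : set R) (x y z : R).

(** [M] is kept separate from [m N]: the inductions below enlarge [M] one element at a time, and
    [N / M] stays a vector space over [R / m] as long as [m N <= M]. *)
Definition spans N M n (e : 'I_n -> R) : Prop :=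
  (forall i, N (e i)) /\
  forall x, N x -> exists a : 'I_n -> R, M (x - \sum_i a i * e i).

(** The linear combinations of a finite generating list form an ideal containing that list, so every
    element of [N] is such a combination exactly, with remainder 0. *)
Lemma noetherian_spans N M : noetherian R -> is_ideal N -> M 0 ->
  exists n (e : 'I_n -> R), spans N M e.
Proof.
move=> noeth idN M0; have [s Ns] := noeth N idN.
pose e (i : 'I_(size s)) := s`_i.
pose C : set R := [set x | exists a : 'I_(size s) -> R, x = \sum_i a i * e i].
have idC : is_ideal C.
  split=> [|_ _ [a ->] [b ->]|c _ [a ->]].
  - by exists (fun=> 0); rewrite big1 // => i _; rewrite mul0r.
  - exists (fun i => a i + b i); rewrite -big_split /=.
    by apply: eq_bigr => i _; rewrite mulrDl.
  - exists (fun i => c * a i); rewrite mulr_sumr.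
    by apply: eq_bigr => i _; rewrite mulrA.
exists (size s), e; split=> [i|x].
  by rewrite Ns => K [_]; apply; rewrite /= mem_nth.
rewrite {1}Ns => /(_ C) [|a ->]; last by exists a; rewrite subrr.
split=> // y /= sy; have lt_y : (index y s < size s)%N by rewrite index_mem.
exists (fun i => (i == Ordinal lt_y)%:R).
rewrite (bigD1 (Ordinal lt_y)) //= eqxx mul1r big1 ?addr0 /e /= ?nth_index //.
by move=> i /negbTE ->; rewrite mul0r.
Qed.

Variable m : set R.
Hypotheses (idm : is_ideal m) (m1 : ~ m 1).
Hypothesis m_inv : forall a, ~ m a -> exists b, m (1 - b * a).

(** Steinitz exchange: [a j] is invertible modulo [m], so the expression of [y] can be solved for
    [e j], which becomes redundant once [y] is killed. *)
Lemma spans_exchange N M n (e : 'I_n.+1 -> R) (a : 'I_n.+1 -> R) (j : 'I_n.+1) y :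
    is_ideal M -> (forall c x, m c -> N x -> M (c * x)) ->
    spans N M e -> ~ m (a j) -> M (y - \sum_i a i * e i) ->
  spans N (adjoin M y) (e \o lift j).
Proof.
move=> idM mNM [Ne Nspan] /m_inv[b mb] My.
split=> [i /=|x /Nspan[u Mu]]; first exact: Ne.
(* Modulo [M], [e j] is [b * a j * e j], that is [b] times [y] minus the other terms; substitute
   this into the expression of [x]. *)
exists (fun i => u (lift j i) - u j * b * a (lift j i)).
move: My Mu; rewrite !(bigD1_ord j) //=.
set A := \sum_i a _ * _; set U := \sum_i u _ * _ => My Mu.
have -> : \sum_i (u (lift j i) - u j * b * a (lift j i)) * e (lift j i)
          = U - u j * b * A.
  rewrite mulr_sumr -sumrB; apply: eq_bigr => i _; ring.
(* The first two terms lie in [M] by [Mu] and [My], the third because [1 - b * a j] is in [m] and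
   [m N <= M]. *)
exists ((x - (u j * e j + U)) - u j * b * (y - (a j * e j + A))
   + u j * ((1 - b * a j) * e j)), (u j * b); split; last by ring.
apply: idealD => //; last by apply: idealM => //; apply: mNM.
by apply: idealB => //; apply: idealM.
Qed.

(** Killing a nonzero class of [N / M] lowers the number of generators by one: if all coefficients
    of [y] were in [m], then [y] would be in [M], so some coefficient is available for the
    exchange. *)
Lemma spans_adjoin N M n (e : 'I_n -> R) y :
    is_ideal M -> (forall c x, m c -> N x -> M (c * x)) ->
    spans N M e -> N y -> ~ M y ->
  exists n' (e' : 'I_n' -> R), n = n'.+1 /\ spans N (adjoin M y) e'.
Proof.
move=> idM mNM Nspan Ny My; have [a May] := Nspan.2 y Ny.
have [j maj] : exists j, ~ m (a j).
  apply: contrapT => ma; apply: My.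
  rewrite -[y](subrK (\sum_i a i * e i)); apply: idealD => //.
  apply: ideal_sum => // i; apply: mNM; last exact: Nspan.1.
  by apply: contrapT => mai; apply: ma; exists i.
case: n => [|n] in e a j Nspan May maj *; first by case: j maj.
by exists n, (e \o lift j); split=> //; apply: spans_exchange maj May.
Qed.

Lemma spansS N M M' n (e : 'I_n -> R) : M `<=` M' -> spans N M e -> spans N M' e.
Proof.
by move=> MM' [Ne Nspan]; split=> // x /Nspan[a Ma]; exists a; apply: MM'.
Qed.

Definition independent M n (e : 'I_n -> R) : Prop :=
  forall a : 'I_n -> R, M (\sum_i a i * e i) -> forall i, m (a i).

(** A relation with a coefficient outside [m] is an exchange against [y = 0]: it drops one generator
    without changing [M], against minimality. *)
Lemma minimal_spans_independent N M n (e : 'I_n -> R) :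
    is_ideal M -> (forall c x, m c -> N x -> M (c * x)) ->
    spans N M e ->
    (forall k (f : 'I_k -> R), spans N M f -> (n <= k)%N) ->
  independent M e.
Proof.
move=> idM mNM; case: n e => [|n] e Nspan nmin a Ma j; first by case: j.
apply: contrapT => maj.
have Nspan0 : spans N (adjoin M 0) (e \o lift j).
  by apply: spans_exchange maj _ => //; rewrite sub0r; apply: idealN.
have /nmin : spans N M (e \o lift j).
  by apply: spansS Nspan0; apply: adjoin_sub => //; apply: ideal0.
by rewrite ltnn.
Qed.

(** Induction on [p]: dividing by [f ord0] shortens the spanning family by one and leaves the
    remaining [f i] independent. *)
Lemma independent_leq_spans N M n p (e : 'I_n -> R) (f : 'I_p -> R) :
    is_ideal M -> (forall c x, m c -> N x -> M (c * x)) ->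
    spans N M e -> (forall i, N (f i)) -> independent M f ->
  (p <= n)%N.
Proof.
elim: p => // p IHp in n M e f *; move=> idM mNM Nspan Nf indf.
have fM : ~ M (f ord0).
  move=> Mf; apply: m1.
  suff /indf/(_ ord0) : M (\sum_i (i == ord0)%:R * f i) by [].
  by rewrite big_ord_recl mul1r big1 ?addr0 // => i _; rewrite mul0r.
have [n' [e' [-> Nspan']]] := spans_adjoin idM mNM Nspan (Nf _) fM.
apply: IHp Nspan' _ _; first exact: adjoin_ideal.
- by move=> c x mc Nx; apply: sub_adjoin; apply: mNM.
- by move=> i; apply: (Nf (lift ord0 i)).
move=> a [u [c [Mu def_u]]] i.
(* The family [- c] followed by [a]: by [def_u] it combines the [f i] to [u], an element of [M]. *)
pose b := oapp a (- c) \o unlift (@ord0 p).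
suff /indf/(_ (lift ord0 i)) : M (\sum_i b i * f i) by rewrite /b /= liftK.
rewrite big_ord_recl /b /= unlift_none /=.
rewrite (eq_bigr (fun i => a i * f (lift ord0 i))) ?def_u; last first.
  by move=> k _; rewrite liftK.
by rewrite addrCA mulNr addNr addr0.
Qed.

Variable I : set R.
Hypothesis idI : is_ideal I.
Let mI := ideal_mul m I.
Let idmI : is_ideal mI := ideal_mul_ideal m I.
Let mImI c x : m c -> I x -> mI (c * x) := fun mc Ix => mem_ideal_mul mc Ix.

(** If [mu] took its default value 0 the bound would be trivial; otherwise it is the size of an
    independent family. *)
Lemma mu_leq_spans n (e : 'I_n -> R) : spans I mI e -> (mu m I <= n)%N.
Proof.
move=> Ie; rewrite /mu; case: xgetP => // p -> [f [If _ indf]].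
exact: (independent_leq_spans idmI mImI Ie If indf).
Qed.

(** A spanning family of least length is a basis, and Noetherianity provides a finite one to start
    from; so the default value of [mu] does not occur. *)
Lemma mu_basis : noetherian R -> exists e : 'I_(mu m I) -> R, is_basis_mod m I e.
Proof.
move=> noeth; rewrite /mu; case: xgetP => [p _ //|noBasis].
pose S : set nat := fun n => exists e : 'I_n -> R, spans I mI e.
have [n Sn] : exists n, S n.
  have [n [e Ie]] := noetherian_spans noeth idI (ideal0 idmI).
  by exists n, e.
have [[e Ie] nmin] := setminP Sn.
case: (noBasis (setmin S)); exists e; case: (Ie) => *; split=> //.
by apply: minimal_spans_independent Ie _ => // k f If; apply: nmin; exists f.
Qed.

Lemma spans_adjoin_factor n (e : 'I_n -> R) z w :
    spans I mI e -> m w -> I (z * w) -> ~ mI (z * w) ->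
  exists f : 'I_n -> R, spans (adjoin I z) (ideal_mul m (adjoin I z)) f.
Proof.
move=> Ie mw Izw mIzw.
have [n' [e' [-> [Ie' span_e']]]] := spans_adjoin idmI mImI Ie Izw mIzw.
have sub : adjoin mI (z * w) `<=` ideal_mul m (adjoin I z).
  apply: adjoin_sub; first exact: ideal_mul_ideal.
    by apply: ideal_mulSr; apply: sub_adjoin.
  by rewrite mulrC; apply: mem_ideal_mul => //; apply: mem_adjoin.
(* The new family is [z] followed by [e']. *)
exists (fun i => oapp e' z (unlift ord0 i)); split=> [i|_ [x [c [Ix ->]]]].
  by case: unliftP => [j|] _ /=; [apply: sub_adjoin|apply: mem_adjoin].
have [a Ma] := span_e' x Ix.
exists (fun i => oapp a c (unlift ord0 i)); apply: sub.
rewrite big_ord_recl unlift_none /=.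
under eq_bigr do rewrite liftK /=.
by rewrite (_ : _ - _ = x - \sum_i a i * e' i) //; ring.
Qed.

End Spanning.

(** * Enlarging an ideal to a reduction, uniformly for both kinds of rings *)

Section Reductions.
Variables (R : comNzRingType) (m : set R) (adm : set (set R)).
Hypotheses (noeth : noetherian R) (idm : is_ideal m) (m1 : ~ m 1).
Hypothesis m_inv : forall a, ~ m a -> exists b, m (1 - b * a).
Hypotheses (adm_ideal : adm `<=` @is_ideal R) (adm_m : adm m).
(** [S] supplies the elements that may be adjoined without leaving the class [adm]: all of [m] in
    the local case, the homogeneous elements of positive degree in the graded case. *)
Variable S : set R.
Hypothesis mS : m = smallest (@is_ideal R) S.
Hypothesis adm_adjoin : forall I z,
  adm I -> ideal_mul m m `<=` I -> S z -> adm (adjoin I z).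
Implicit Types I J : set R.

Let Sm : S `<=` m.
Proof. by rewrite mS => x Sx K [_]; apply. Qed.

(** The elements [x] with [x m <= m I] form an ideal, so if it contained the generators [S] of [m]
    it would contain [m]. Hence [z] can be taken in [S], while [w] is arbitrary in [m]. *)
Lemma not_reduction_witness I : I `<=` m -> ideal_mul m I <> ideal_mul m m ->
  exists z w, [/\ S z, m w & ~ ideal_mul m I (z * w)].
Proof.
move=> Im neq; apply: contrapT => noW; apply: neq.
have idmI := ideal_mul_ideal m I.
apply/seteqP; split; first exact: ideal_mulSr.
apply: ideal_mul_sub => // x y mx; move: x mx y; rewrite {1}mS.
apply: smallest_sub => [|z Sz w mw]; last first.
  by apply: contrapT => zw; apply: noW; exists z, w.
split=> [y _|x x' xm x'm y my|a x xm y my].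
- by rewrite mul0r; apply: ideal0.
- by rewrite mulrDl; apply: (idealD idmI); [apply: xm|apply: x'm].
- by rewrite -mulrA; apply: (idealM _ idmI); apply: xm.
Qed.

(** Induction on [t], a bound for the length of [m^2 / m I]: each adjunction lowers [t] by one and
    keeps the number [n] of generators. *)
Lemma enlarge_to_reduction t n I (g : 'I_t -> R) (e : 'I_n -> R) :
    adm I -> ideal_mul m m `<=` I -> I `<=` m ->
    spans (ideal_mul m m) (ideal_mul m I) g -> spans I (ideal_mul m I) e ->
  exists J, [/\ adm J, J `<=` m, ideal_mul m J = ideal_mul m m
              & exists f : 'I_n -> R, spans J (ideal_mul m J) f].
Proof.
elim: t => [|t IHt] in I g e *; move=> admI mmI Im mmg Ie.
  (* With [t = 0] the empty family spans, that is, [m^2 <= m I]. *)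
  exists I; split=> //; last by exists e.
  apply/seteqP; split; first exact: ideal_mulSr.
  by move=> x /(mmg.2)[a]; rewrite big_ord0 subr0.
have [eqm|neqm] := pselect (ideal_mul m I = ideal_mul m m).
  by exists I; split=> //; exists e.
have [z [w [Sz mw mIzw]]] := not_reduction_witness Im neqm.
have mz := Sm Sz; have idI := adm_ideal admI; have idmI := ideal_mul_ideal m I.
have mmzw : ideal_mul m m (z * w) by apply: mem_ideal_mul.
have [e' Ie'] := spans_adjoin_factor m_inv idI Ie mw (mmI _ mmzw) mIzw.
(* [m] kills [m^2 / m I] because [m^2 <= I], as the exchange requires. *)
have mmM c x : m c -> ideal_mul m m x -> ideal_mul m I (c * x).
  by move=> mc /mmI; apply: mem_ideal_mul.
have [t' [g' [[t't] mmg']]] := spans_adjoin m_inv idmI mmM mmg mmzw mIzw.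
subst t'.
apply: (IHt (adjoin I z) g' e') => //.
- exact: adm_adjoin.
- by apply: subset_trans mmI _; apply: sub_adjoin.
- exact: adjoin_sub.
apply: spansS mmg'; apply: adjoin_sub; first exact: ideal_mul_ideal.
  by apply: ideal_mulSr; apply: sub_adjoin.
by rewrite mulrC; apply: mem_ideal_mul => //; apply: mem_adjoin.
Qed.

Let reduction_exponents J : set nat :=
  [set r | ideal_exp m r.+1 = ideal_mul (ideal_exp m r) J].

Lemma reduction_equation0 J : is_ideal J ->
  ideal_exp m 1 = ideal_mul (ideal_exp m 0) J <-> m = J.
Proof. by move=> idJ; rewrite ideal_exp1 // ideal_mulTl. Qed.

Lemma reduction_equation1 J : is_ideal J ->
  ideal_exp m 2 = ideal_mul (ideal_exp m 1) J <-> ideal_mul m m = ideal_mul m J.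
Proof. by move=> idJ; rewrite ideal_exp2 // ideal_exp1. Qed.

Lemma reduction_numberP J : reduction J m ->
  let r := reduction_number m J in
  ideal_exp m r.+1 = ideal_mul (ideal_exp m r) J.
Proof. by move=> [_ [r Er]]; exact: (@setminP (reduction_exponents J) _ Er).1. Qed.

Lemma reduction_number_leq J r :
  ideal_exp m r.+1 = ideal_mul (ideal_exp m r) J -> (reduction_number m J <= r)%N.
Proof. by move=> Er; exact: (@setminP (reduction_exponents J) _ Er).2. Qed.

(** Reduction number 0 means [J = m], where [m J = m^2] holds as well, so one equation covers both
    values. *)
Lemma reductions_number_le1P J : reductions_number_le1 m adm J <->
  [/\ adm J, J `<=` m & ideal_mul m J = ideal_mul m m].
Proof.
split=> [[admJ redJ rn]|[admJ Jm Em]]; have idJ := adm_ideal admJ.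
  split=> //; first by case: redJ.
  move: (reduction_numberP redJ) => /=.
  case: (reduction_number m J) rn => [|[|//]] _.
    by move=> /(reduction_equation0 idJ) ->.
  by move=> /(reduction_equation1 idJ) ->.
have E1 : ideal_exp m 2 = ideal_mul (ideal_exp m 1) J.
  exact/(reduction_equation1 idJ).
by split; [|split=> //; exists 1%N|exact: reduction_number_leq].
Qed.

Lemma reductions_number_oneP J : reductions_number_one m adm J <->
  reductions_number_le1 m adm J /\ J <> m.
Proof.
split=> [[admJ redJ rn]|[[admJ redJ rn] Jm]]; have idJ := adm_ideal admJ.
  split; first by split; rewrite ?rn.
  by move=> Jm; have := reduction_number_leq ((reduction_equation0 idJ).2 (esym Jm));
    rewrite rn.
split=> //; move: (reduction_numberP redJ) => /=.
case: (reduction_number m J) rn => [|[|//]] _ // /(reduction_equation0 idJ) mJ.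
by case: Jm.
Qed.

Lemma ms_leq J : reductions_number_le1 m adm J -> (ms m adm <= mu m J)%N.
Proof.
move=> /reductions_number_le1P[admJ Jm Em]; have idJ := adm_ideal admJ.
have msJ : [set mu m I | I in
    [set I | [/\ adm I, I `<=` m & ideal_exp m 2 `<=` I]]] (mu m J).
  exists J => //; split=> //; rewrite ideal_exp2 // -Em.
  exact: ideal_mul_subr.
by have [_] := setminP msJ; apply.
Qed.

(** An ideal realizing [ms] is enlarged to a reduction with no more generators; [ms_leq] forbids
    fewer. *)
Lemma ms_attained : exists2 J, reductions_number_le1 m adm J & mu m J = ms m adm.
Proof.
have ms_m : [set mu m I | I in
    [set I | [/\ adm I, I `<=` m & ideal_exp m 2 `<=` I]]] (mu m m).
  by exists m => //; split=> //; rewrite ideal_exp2 //; apply: ideal_mul_subr.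
have [[I [admI Im mmI] muI] _] := setminP ms_m.
rewrite ideal_exp2 // in mmI; rewrite -/(ms m adm) in muI.
have idI := adm_ideal admI.
have [e [Ie span_e _]] := mu_basis m_inv idI noeth.
have [t [g mmg]] := noetherian_spans noeth (ideal_mul_ideal m m)
  (ideal0 (ideal_mul_ideal m I)).
have [J [admJ Jm Em [f Jf]]] :=
  enlarge_to_reduction admI mmI Im mmg (conj Ie span_e).
have redJ : reductions_number_le1 m adm J by apply/reductions_number_le1P.
exists J => //; apply/eqP; rewrite eqn_leq ms_leq // andbT -muI.
by apply: mu_leq_spans Jf => //; apply: adm_ideal.
Qed.

(** Since [m J = m^2], the space [J / m J] embeds in [m / m^2]. This serves the case where the
    enlargement ends at [m] itself. *)
Lemma mu_leq_of_reduction J :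
  reductions_number_le1 m adm J -> (mu m J <= mu m m)%N.
Proof.
move=> /reductions_number_le1P[admJ Jm Em].
have [e [me span_e _]] := mu_basis m_inv idm noeth.
have [f [Jf _ indf]] := mu_basis m_inv (adm_ideal admJ) noeth.
rewrite Em in indf.
have mmM c x : m c -> m x -> ideal_mul m m (c * x) by apply: mem_ideal_mul.
have idmm := ideal_mul_ideal m m.
apply: (independent_leq_spans m1 m_inv idmm mmM (conj me span_e) _ indf) => i.
exact: Jm.
Qed.

Lemma ms_is_min_le1 :
  is_min [set mu m I | I in reductions_number_le1 m adm] (ms m adm).
Proof.
split; first by have [J redJ <-] := ms_attained; exists J.
by move=> _ [J redJ <-]; apply: ms_leq.
Qed.

Lemma ms_is_min_one : reductions_number_one m adm !=set0 ->
  is_min [set mu m I | I in reductions_number_one m adm] (ms m adm).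
Proof.
case=> K oneK; split; last first.
  by move=> _ [J /reductions_number_oneP[redJ _] <-]; apply: ms_leq.
have [J redJ muJ] := ms_attained.
have [Jm|Jm] := pselect (J = m).
  (* Here [m], whose reduction number is 0, realizes [ms]; then [K] does too, since
     [ms <= mu K <= mu m = ms]. *)
  exists K => //; have [redK _] := (reductions_number_oneP K).1 oneK.
  apply/eqP; rewrite eqn_leq ms_leq // andbT -muJ Jm.
  exact: mu_leq_of_reduction.
by exists J => //; apply/reductions_number_oneP.
Qed.

End Reductions.

Lemma maximal_ideal_inv (R : comNzRingType) (m : set R) a :
  maximal_ideal m -> ~ m a -> exists b, m (1 - b * a).
Proof.
move=> [idm _ mmax] ma.
have [Em|ET] := mmax _ (adjoin_ideal a idm) (@sub_adjoin _ m a).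
  by case: ma; rewrite -Em; apply: mem_adjoin.
have [y [b [my E]]] : adjoin m a 1 by rewrite ET.
by exists b; rewrite E addrK.
Qed.

(** * The irrelevant ideal of a graded ring and its homogeneous extensions *)

Section Graded.
Variables (R : comNzRingType) (G : nat -> set R).
Hypothesis gradG : is_grading G.
Hypothesis G0field : forall x, G 0%N x -> x != 0 -> exists2 y, G 0%N y & x * y = 1.
Let m := irrelevant_ideal G.

Lemma grading0 i : G i 0.
Proof. by case: gradG => /(_ i) [/set_mem]. Qed.

Lemma gradingB i x y : G i x -> G i y -> G i (x - y).
Proof.
by case: gradG => /(_ i) [_ GB] *; apply/set_mem/GB; apply/mem_set.
Qed.

Lemma gradingM i j x y : G i x -> G j y -> G (i + j)%N (x * y).
Proof. by case: gradG => _ [_ +] _ _; apply. Qed.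

Lemma gradingD i x y : G i x -> G i y -> G i (x + y).
Proof.
move=> Gx Gy; rewrite -[y]opprK -[- y]sub0r; apply: gradingB => //.
by apply: gradingB => //; apply: grading0.
Qed.

Lemma homogeneous_in_irrelevant i x : G i.+1 x -> m x.
Proof.
move=> Gx; exists i.+1, (fun j => if j == i then x else 0); split.
  by move=> j; case: eqP => [->//|_]; apply: grading0.
rewrite big_ord_recr /= eqxx big1 ?add0r // => j _.
by rewrite ltn_eqF.
Qed.

(** Decompositions come with arbitrary lengths; padding with zeros lets two of them be added degree
    by degree. *)
Lemma big_ord_pad n N (c : nat -> R) : (n <= N)%N ->
  \sum_(i < n) c i = \sum_(i < N) (if (i < n)%N then c i else 0).
Proof. by move=> nN; rewrite (big_ord_widen N) // -big_mkcond. Qed.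

Lemma grading_pad n i j (c : nat -> R) :
  G i (c j) -> G i (if (j < n)%N then c j else 0).
Proof. by case: ifP => // _ _; apply: grading0. Qed.

Lemma irrelevantD x y : m x -> m y -> m (x + y).
Proof.
move=> [n [c [Gc ->]]] [p [d [Gd ->]]].
exists (maxn n p), (fun i => (if (i < n)%N then c i else 0)
                             + (if (i < p)%N then d i else 0)).
split=> [i|]; first by apply: gradingD; apply: grading_pad.
by rewrite big_split /= -!big_ord_pad ?leq_maxl ?leq_maxr.
Qed.

Lemma irrelevant_split x : exists x0 y, [/\ G 0%N x0, m y & x = x0 + y].
Proof.
case: gradG => _ _ /(_ x)[[|n] [c [Gc ->]]] _.
  exists 0, 0; rewrite big_ord0 addr0; split=> //; first exact: grading0.
  exact: (homogeneous_in_irrelevant (grading0 1)).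
rewrite big_ord_recl; exists (c 0%N), (\sum_(i < n) c i.+1); split=> //.
by exists n, (fun i => c i.+1).
Qed.

Lemma irrelevant_sum n (F : 'I_n -> R) : (forall i, m (F i)) -> m (\sum_i F i).
Proof.
move=> mF; elim/big_ind: _ => //; last exact: irrelevantD.
exact: (homogeneous_in_irrelevant (grading0 1)).
Qed.

Lemma irrelevant_ideal_is_ideal : is_ideal m.
Proof.
split; [|exact: irrelevantD|].
  exact: (homogeneous_in_irrelevant (grading0 1)).
move=> a _ [n [c [Gc ->]]]; case: gradG => _ _ /(_ a)[p [b [Gb ->]]] _.
rewrite mulr_suml; apply: irrelevant_sum => i.
rewrite mulr_sumr; apply: irrelevant_sum => j.
by apply: (@homogeneous_in_irrelevant (i + j)); rewrite -addnS; apply: gradingM.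
Qed.

Let idm := irrelevant_ideal_is_ideal.

Lemma irrelevant_smallest : m = smallest (@is_ideal R) (\bigcup_i G i.+1).
Proof.
apply/seteqP; split=> [_ [n [c [Gc ->]]] K [idK GK]|].
  by apply: ideal_sum => // i; apply: GK; exists (i : nat).
by apply: smallest_sub => // x [i _]; apply: homogeneous_in_irrelevant.
Qed.

Lemma irrelevant_deg0 x : G 0%N x -> m x -> x = 0.
Proof.
move=> Gx [n [c [Gc xE]]]; case: gradG => _ _ _.
(* Placing [- x] in degree 0 before the components of positive degree gives a decomposition of 0, to
   which uniqueness applies. *)
pose d i := if i is i'.+1 then c i' else - x.
have Gd i : G i (d i).
  by case: i => [|i] //=; rewrite -sub0r; apply: gradingB => //; apply: grading0.
move=> /(_ n.+1 d Gd); rewrite big_ord_recl /= -xE addNr => /(_ erefl 0%N erefl).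
by move=> /eqP; rewrite oppr_eq0 => /eqP.
Qed.

Lemma irrelevant_proper : ~ m 1.
Proof.
have [_ [G1 _] _ _] := gradG.
by move=> /(irrelevant_deg0 G1)/eqP; rewrite oner_eq0.
Qed.

(** The degree 0 part of [a] is nonzero, and its inverse in the field [G 0] inverts [a] modulo
    [m]. *)
Lemma irrelevant_inv a : ~ m a -> exists b, m (1 - b * a).
Proof.
move=> ma; have [x [y [Gx my aE]]] := irrelevant_split a.
have [x0|/(G0field Gx)[b _ xb]] := eqVneq x 0.
  by case: ma; rewrite aE x0 add0r.
exists b; rewrite aE (_ : _ - _ = - b * y); first exact: idealM.
by rewrite -xb; ring.
Qed.

Lemma irrelevant_homogeneous : homogeneous_ideal G m.
Proof.
split=> // -[|n] c Gc mc [|i] // _; last exact: homogeneous_in_irrelevant (Gc _).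
rewrite big_ord_recl in mc.
(* The degree 0 component is the whole sum minus components of positive degree, all in [m]. *)
rewrite -[c 0%N](addrK (\sum_(i < n) c i.+1)); apply: idealB => //.
by apply: ideal_sum => // i; apply: homogeneous_in_irrelevant (Gc _).
Qed.

(* Only the degree 0 part of a coefficient of [z] matters, because [m z] lies
   in [I]; so modulo [I] every element of [I + (z)] is homogeneous of degree
   [d + 1]. *)
Lemma adjoin_homogeneous I z d : homogeneous_ideal G I ->
  ideal_mul m m `<=` I -> G d.+1 z -> homogeneous_ideal G (adjoin I z).
Proof.
move=> [idI homI] mmI Gz; split; first exact: adjoin_ideal.
move=> n c Gc [y [a [Iy sum_c]]] i ltin.
have [a0 [b [Ga0 mb aE]]] := irrelevant_split a.
(* Removing [a0 * z] from degree [d.+1] leaves the components of [y + b * z], which is in [I].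
   Summing up to [n + d.+2] includes the index [d.+1] even when it is at least [n]. *)
pose c' j := (if (j < n)%N then c j else 0) - (if j == d.+1 then a0 * z else 0).
have Gc' j : G j (c' j).
  apply: gradingB; first exact: grading_pad.
  by case: eqP => [->|_]; [apply: (gradingM Ga0 Gz)|apply: grading0].
have sum_c' : \sum_(j < n + d.+2) c' j = y + b * z.
  rewrite sumrB -big_ord_pad ?leq_addr // sum_c aE -big_mkcond /=.
  have ltd : (d.+1 < n + d.+2)%N by rewrite addnS ltnS leq_addl.
  rewrite (big_pred1 (Ordinal ltd)) //; ring.
have Ic' : I (c' i).
  apply: (homI (n + d.+2)%N) => //; last exact: ltn_addr.
  rewrite sum_c'; apply: idealD => //; apply: mmI; apply: mem_ideal_mul => //.
  exact: homogeneous_in_irrelevant Gz.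
exists (c' i), (if i == d.+1 then a0 else 0); split=> //.
by rewrite /c' ltin; case: ifP => _; ring.
Qed.

End Graded.

(** * The local and graded cases *)

Theorem corollary2p8 (R : comNzRingType) (m : set R) (adm : set (set R))
    (hR : local_or_standard_graded m adm)
    (hm : ideal_exp m 2 <> [set 0]) :
  (reductions_number_one m adm !=set0 ->
     is_min [set mu m I | I in reductions_number_one m adm] (ms m adm)) /\
  is_min [set mu m I | I in reductions_number_le1 m adm] (ms m adm).
Proof.
case: hR hm => {m adm} [m noeth [maxm _]|G noeth [gradG G0field _]] _.
  have [idm neqT _] := maxm.
  have m1 : ~ m 1.
    move=> m1; apply: neqT; apply/seteqP; split=> // x _.
    by rewrite -[x]mulr1; apply: idealM.
  have m_inv a := @maximal_ideal_inv _ _ a maxm.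
  have mS : m = smallest (@is_ideal R) m by rewrite smallest_id.
  have adj I z : is_ideal I -> ideal_mul m m `<=` I -> m z ->
      is_ideal (adjoin I z) by move=> *; apply: adjoin_ideal.
  split; first exact: (ms_is_min_one noeth idm m1 m_inv _ idm mS adj).
  exact: (ms_is_min_le1 noeth idm m1 m_inv _ idm mS adj).
have idm := irrelevant_ideal_is_ideal gradG.
have m1 := irrelevant_proper gradG.
have m_inv := irrelevant_inv gradG G0field.
have adm_ideal : homogeneous_ideal G `<=` @is_ideal R by move=> I [].
have adm_m := irrelevant_homogeneous gradG.
have mS := irrelevant_smallest gradG.
have adj I z : homogeneous_ideal G I ->
    ideal_mul (irrelevant_ideal G) (irrelevant_ideal G) `<=` I ->
    (\bigcup_i G i.+1) z -> homogeneous_ideal G (adjoin I z).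
  by move=> homI mmI [d _]; apply: adjoin_homogeneous.
split; first exact: (ms_is_min_one noeth idm m1 m_inv adm_ideal adm_m mS adj).
exact: (ms_is_min_le1 noeth idm m1 m_inv adm_ideal adm_m mS adj).
Qed.
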